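(* Let $F$ be a field of characteristic zero over which the norm of any quaternion algebra is surjective, let $d\in F^*\setminus {F^*}^2$, and set $K=F(\sqrt d)$. Then there is a one-to-one correspondence between $H^1_d(r_{DJ},F,d)$ and $(F^*/N(K^* ))^{n-1}$.
   Context: $n$ is a positive integer. The nontrivial element of $\mathrm{Gal}(K/F)$ is $z\mapsto\overline z$, applied entrywise to matrices; $X^*=\overline X^T$, and $N(z)=\overline z z$ is the norm $K\to F$. $\mathrm U(n,d)(F)=\{X\in\mathrm{GL}(n,K):X^*X=1\}$. For $a,b\in F^*$, the quaternion algebra $(a,b)_F$ has basis $1,i,j,ij$ with $i^2=a$, $j^2=b$, $ji=-ij$; its norm is the quadratic form $x1+yi+zj+wij\mapsto(x^2-ay^2)-b(z^2-aw^2)$, regarded as a map to $F$. A (diagonal type Belavin--Drinfeld) cocycle is a matrix $X\in\mathrm{GL}(n,K)$ such that $X^*X$ is equal to a diagonal matrix $D_X\in\mathrm{GL}(n,F)$. Two cocycles $X,Y$ are cohomologous if $Y=QXD$ for some $Q\in\mathrm U(n,d)(F)$ and some diagonal $D\in\mathrm{GL}(n,K)$. $H^1_d(r_{DJ},F,d)$ is the set of cohomology classes of cocycles. *)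

(* Defs.v *)
From HB Require Import structures.
From mathcomp Require Import all_boot all_order all_algebra all_fingroup all_field.
From mathcomp Require Import boolp.

Set Implicit Arguments.
Unset Strict Implicit.
Unset Printing Implicit Defensive.

Import GRing.Theory.
Local Open Scope ring_scope.
Local Open Scope quotient_scope.

(* The element x1 + yi + zj + w(ij) of the quaternion algebra (a,b)_F, where
   i^2 = a, j^2 = b and ji = -ij, given by its coordinates (x, y, z, w). *)
Record quaternion (F : fieldType) (a b : F) := Quaternion {
  quat_1 : F; quat_i : F; quat_j : F; quat_ij : F }.

Definition quat_norm (F : fieldType) (a b : F) (q : quaternion a b) : F :=
  (quat_1 q ^+ 2 - a * quat_i q ^+ 2) - b * (quat_j q ^+ 2 - a * quat_ij q ^+ 2).

(* Throughout, sigma stands for the conjugation of the quadratic extension K/F.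
   The definitions make sense, and the two relations below are equivalences,
   for every automorphism sigma of K over F. *)
Section Conjugation.

Variables (F : fieldType) (K : splittingFieldType F) (sigma : gal_of {:K}).

Definition norm (z : K) : K := sigma z * z.

Definition adjoint n (X : 'M[K]_n) : 'M[K]_n := (map_mx sigma X)^T.

Definition unitary n (X : 'M[K]_n) : Prop :=
  X \in unitmx /\ adjoint X *m X = 1%:M.

Definition cocycle n (X : 'M[K]_n) : Prop :=
  X \in unitmx /\
  exists D : 'M[F]_n,
    [/\ D \in unitmx, is_diag_mx D & adjoint X *m X = map_mx (in_alg K) D].

Definition cohomologous n (X Y : 'M[K]_n) : Prop :=
  exists Q D : 'M[K]_n,
    [/\ unitary Q, D \in unitmx, is_diag_mx D & Y = Q *m X *m D].

Lemma adjointM n (X Y : 'M[K]_n) :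
  adjoint (X *m Y) = adjoint Y *m adjoint X.
Proof. by rewrite /adjoint map_mxM trmx_mul. Qed.

Lemma adjoint1 n : adjoint (1%:M : 'M[K]_n) = 1%:M.
Proof. by rewrite /adjoint map_mx1 tr_scalar_mx. Qed.

Lemma unitary1 n : unitary (1%:M : 'M[K]_n).
Proof. by split; [exact: unitmx1 | rewrite adjoint1 mulmx1]. Qed.

Lemma unitaryM n (X Y : 'M[K]_n) : unitary X -> unitary Y -> unitary (X *m Y).
Proof.
move=> [uX eX] [uY eY]; split; first by rewrite unitmx_mul uX.
by rewrite adjointM -mulmxA (mulmxA (adjoint X)) eX mul1mx.
Qed.

Lemma unitaryV n (X : 'M[K]_n) : unitary X -> unitary (invmx X).
Proof.
move=> [uX eX]; split; first by rewrite unitmx_inv.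
have eV : adjoint (invmx X) *m adjoint X = 1%:M.
  by rewrite -adjointM mulmxV // adjoint1.
have eX' : invmx X = adjoint X.
  by rewrite -[LHS]mul1mx -eX -mulmxA mulmxV // mulmx1.
by rewrite {2}eX'.
Qed.

Lemma is_diag_mxM n (D E : 'M[K]_n) :
  is_diag_mx D -> is_diag_mx E -> is_diag_mx (D *m E).
Proof.
move=> /is_diag_mxP hD /is_diag_mxP hE; apply/is_diag_mxP => i j ij.
rewrite mxE big1 // => k _.
have [ik|ik] := eqVneq i k; last by rewrite hD // mul0r.
by rewrite hE ?mulr0 // -ik.
Qed.

Lemma is_diag_mxV n (D : 'M[K]_n) :
  D \in unitmx -> is_diag_mx D -> is_diag_mx (invmx D).
Proof.
move=> uD /is_diag_mxP hD; apply/is_diag_mxP => i j ij.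
have /matrixP /(_ i j) := mulmxV uD.
have /matrixP /(_ i i) := mulmxV uD.
have D0 k : k != i -> D i k = 0 by move=> ki; apply: hD; rewrite eq_sym.
rewrite !mxE (bigD1 i) //= big1 => [|k ki]; last by rewrite D0 ?mul0r.
rewrite eqxx addr0 => Dii.
rewrite (bigD1 i) //= big1 => [|k ki]; last by rewrite D0 ?mul0r.
have -> : (i == j) = false by apply/negbTE.
rewrite addr0 => /eqP; rewrite mulf_eq0 => /orP[/eqP Di0|/eqP //].
by move: Dii; rewrite Di0 mul0r => /esym /eqP; rewrite oner_eq0.
Qed.

Definition cocycle_type n := {X : 'M[K]_n | `[< cocycle X >]}.

Definition cohomologousb n : rel (cocycle_type n) :=
  fun X Y => `[< cohomologous (val X) (val Y) >].

Lemma cohomologousb_refl n : reflexive (@cohomologousb n).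
Proof.
move=> X; apply/asboolP; exists 1%:M, 1%:M; split.
- exact: unitary1.
- exact: unitmx1.
- exact: scalar_mx_is_diag.
- by rewrite mul1mx mulmx1.
Qed.

Lemma cohomologousb_sym n : symmetric (@cohomologousb n).
Proof.
suff h (X Y : cocycle_type n) : cohomologousb X Y -> cohomologousb Y X.
  by move=> X Y; apply/idP/idP; apply: h.
move=> /asboolP [Q [D [uQ uD dD eY]]]; apply/asboolP.
exists (invmx Q), (invmx D); split.
- exact: unitaryV.
- by rewrite unitmx_inv.
- exact: is_diag_mxV.
- by rewrite eY !mulmxA mulVmx ?mul1mx ?mulmxK //; case: uQ.
Qed.

Lemma cohomologousb_trans n : transitive (@cohomologousb n).
Proof.
move=> Y X Z /asboolP [Q [D [uQ uD dD eY]]] /asboolP [R [E [uR uE dE eZ]]].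
apply/asboolP; exists (R *m Q), (D *m E); split.
- exact: unitaryM.
- by rewrite unitmx_mul uD.
- exact: is_diag_mxM.
- by rewrite eZ eY !mulmxA.
Qed.

Definition cohomologous_equiv n : equiv_rel (cocycle_type n) :=
  EquivRel (@cohomologousb n) (@cohomologousb_refl n) (@cohomologousb_sym n)
    (@cohomologousb_trans n).

(* H^1_d(r_DJ, F, d) *)
Definition H1_d n := {eq_quot (cohomologous_equiv n)}.

Definition nonzero := {x : F | x != 0}.

Definition norm_eqb : rel nonzero := fun x y =>
  `[< exists2 z : K, z != 0 & (val x / val y)%:A = norm z >].

Lemma normM (z w : K) : norm (z * w) = norm z * norm w.
Proof. by rewrite /norm rmorphM /= mulrACA. Qed.

Lemma norm_eqb_refl : reflexive norm_eqb.
Proof.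
move=> x; apply/asboolP; exists 1; first exact: oner_neq0.
by rewrite divff ?(valP x) // /norm rmorph1 mulr1 scale1r.
Qed.

Lemma norm_eqb_sym : symmetric norm_eqb.
Proof.
suff h (x y : nonzero) : norm_eqb x y -> norm_eqb y x.
  by move=> x y; apply/idP/idP; apply: h.
move=> /asboolP [z z0 e]; apply/asboolP; exists z^-1; first by rewrite invr_neq0.
have -> : norm z^-1 = (norm z)^-1 by rewrite /norm fmorphV invfM.
by rewrite -e -!in_algE -fmorphV /= invf_div.
Qed.

Lemma norm_eqb_trans : transitive norm_eqb.
Proof.
move=> y x t /asboolP [z z0 ez] /asboolP [w w0 ew]; apply/asboolP.
exists (z * w); first by rewrite mulf_neq0.
rewrite normM -ez -ew -!in_algE -rmorphM /=.
by rewrite mulrA divfK // (valP y).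
Qed.

Definition norm_equiv : equiv_rel nonzero :=
  EquivRel norm_eqb norm_eqb_refl norm_eqb_sym norm_eqb_trans.

(* F^* / N(K^* ) *)
Definition norm_classes := {eq_quot norm_equiv}.

End Conjugation.

(* Main.v *)
Require Import Defs.
From HB Require Import structures.
From mathcomp Require Import all_boot all_order all_algebra all_fingroup all_field.
From mathcomp Require Import boolp ring generic_quotient.

Set Implicit Arguments.
Unset Strict Implicit.
Unset Printing Implicit Defensive.

Import GRing.Theory.
Local Open Scope ring_scope.

(* A cocycle class is the same as a diagonal Hermitian form <d_1, ..., d_n>
   isometric to <1, ..., 1>, with the d_i taken modulo norms.  Since a binary
   form <a, b> represents c as soon as the norm of the quaternion algebra
   (d, -b/a) represents c/a, every binary form represents 1, so that
   <a, b> = <1, ab>.  By induction, diagonal forms of rank n are classified by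
   their determinant modulo norms.  Hence d_2, ..., d_n are arbitrary, and d_1
   is determined modulo norms by the condition that the product is a norm. *)

(** * The norms from [K] as a subgroup of the nonzero elements of [F] *)

Section NormGroup.

Variables (F : fieldType) (K : splittingFieldType F) (sigma : gal_of {:K}).

Definition is_norm (x : F) : Prop := exists2 z : K, z != 0 & x%:A = norm sigma z.

Lemma norm_neq0 (z : K) : z != 0 -> norm sigma z != 0.
Proof. by move=> z0; rewrite mulf_neq0 ?fmorph_eq0. Qed.

Lemma is_norm_neq0 (x : F) : is_norm x -> x != 0.
Proof.
by move=> [z /norm_neq0 z0 e]; apply: contraNneq z0 => x0; rewrite -e x0 scale0r.
Qed.

Lemma is_norm1 : is_norm 1.
Proof. by exists 1; rewrite ?oner_neq0 // /norm rmorph1 mulr1 scale1r. Qed.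

Lemma is_normM (x y : F) : is_norm x -> is_norm y -> is_norm (x * y).
Proof.
move=> [z z0 ez] [w w0 ew]; exists (z * w); first by rewrite mulf_neq0.
by rewrite normM -ez -ew -!in_algE rmorphM.
Qed.

Lemma is_normV (x : F) : is_norm x -> is_norm x^-1.
Proof.
move=> [z z0 ez]; exists z^-1; first by rewrite invr_neq0.
by rewrite /norm fmorphV -invfM -/(norm sigma z) -ez -!in_algE fmorphV.
Qed.

Lemma is_norm_prod (I : finType) (x : I -> F) :
  (forall i, is_norm (x i)) -> is_norm (\prod_i x i).
Proof.
by move=> hx; elim/big_ind: _ => //; [exact: is_norm1 | exact: is_normM].
Qed.

End NormGroup.

(** * Which diagonal matrices over [F] have the form [X^* X] *)

Section Gram.

Variables (F : fieldType) (K : splittingFieldType F) (sigma : gal_of {:K}).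

Lemma gal_scalar (c : F) : sigma c%:A = c%:A.
Proof. by rewrite linearZ /= rmorph1. Qed.

Lemma adjoint_block m n (A : 'M[K]_m) (B : 'M_(m, n)) (C : 'M_(n, m)) (D : 'M_n) :
  adjoint sigma (block_mx A B C D) =
  block_mx (adjoint sigma A) (map_mx sigma C)^T (map_mx sigma B)^T (adjoint sigma D).
Proof. by rewrite /adjoint map_block_mx tr_block_mx. Qed.

Lemma adjoint_scalar n (a : K) : adjoint sigma (a%:M : 'M_n) = (sigma a)%:M.
Proof. by rewrite /adjoint map_scalar_mx tr_scalar_mx. Qed.

Lemma det_adjoint n (X : 'M[K]_n) : \det (adjoint sigma X) = sigma (\det X).
Proof. by rewrite det_tr det_map_mx. Qed.

Lemma det_gram n (X : 'M[K]_n) :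
  \det (adjoint sigma X *m X) = norm sigma (\det X).
Proof. by rewrite det_mulmx det_adjoint. Qed.

(** For the conjugation [sigma], these are the Hermitian forms isometric to [<1, ..., 1>]. *)
Definition is_gram n (H : 'M[K]_n) : Prop :=
  exists2 X, X \in unitmx & adjoint sigma X *m X = H.

(** If [P^* H P = X^* X], then [X P^-1] has Gram matrix [H]. Here [P] is invertible because the
    determinant of [X^* X] is the norm of [\det X], hence nonzero. *)
Lemma is_gram_congr n (P H : 'M[K]_n) :
  is_gram (adjoint sigma P *m H *m P) -> is_gram H.
Proof.
move=> [X uX e].
have uP : P \in unitmx.
  have : \det (adjoint sigma X *m X) != 0.
    by rewrite det_gram norm_neq0 // -unitfE -unitmxE.
  by rewrite e det_mulmx mulf_eq0 negb_or unitmxE unitfE => /andP[].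
have eV : adjoint sigma (invmx P) *m adjoint sigma P = 1%:M.
  by rewrite -adjointM mulmxV // adjoint1.
exists (X *m invmx P); first by rewrite unitmx_mul uX unitmx_inv.
rewrite adjointM -mulmxA (mulmxA _ X) e !mulmxA eV mul1mx -mulmxA.
by rewrite mulmxV // mulmx1.
Qed.

Lemma is_gram_block1 n (H : 'M[K]_n) :
  is_gram H -> is_gram (block_mx (1%:M : 'M_1) 0 0 H).
Proof.
move=> [X uX eX]; exists (block_mx 1%:M 0 0 X).
  by rewrite unitmxE det_ublock det1 mul1r -unitmxE.
rewrite adjoint_block adjoint1 !map_mx0 !trmx0 mulmx_block eX.
by rewrite !mulmx0 !mul0mx !mul1mx !addr0 add0r.
Qed.

(* The columns (z, w) and (- b sigma(w), a sigma(z)) form an orthogonal basis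
   of the binary form <a, b>, with values 1 and ab. *)
Lemma is_gram_merge n (a b : F) (H : 'M[K]_n) (z w : K) :
  sigma (sigma z) = z -> sigma (sigma w) = w ->
  a%:A * norm sigma z + b%:A * norm sigma w = 1 ->
  is_gram (block_mx ((a * b)%:A%:M : 'M_1) 0 0 H) ->
  is_gram (block_mx (a%:A%:M : 'M_1) 0 0 (block_mx (b%:A%:M : 'M_1) 0 0 H)).
Proof.
move=> zz ww e1 gH.
pose y := - b%:A * sigma w; pose t := a%:A * sigma z.
(* [P] changes basis in the first two coordinates and is the identity on the other [n]. *)
pose P : 'M[K]_(1 + (1 + n)) :=
  block_mx z%:M (row_mx y%:M 0) (col_mx w%:M 0) (block_mx t%:M 0 0 1%:M).
apply: (@is_gram_congr _ P).
suff -> : adjoint sigma P *m block_mx (a%:A%:M : 'M_1) 0 0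
            (block_mx (b%:A%:M : 'M_1) 0 0 H) *m P
        = block_mx (1%:M : 'M_1) 0 0 (block_mx ((a * b)%:A%:M : 'M_1) 0 0 H).
  exact: is_gram_block1.
rewrite /P !adjoint_block !map_row_mx !map_col_mx !tr_row_mx !tr_col_mx.
rewrite !adjoint_scalar !map_scalar_mx !tr_scalar_mx !map_mx0 !trmx0 !mulmx_block.
rewrite !(mul_row_block, mul_block_col, mul_row_col, mul_col_row).
rewrite !(mul_mx_row, mul_col_mx).
rewrite !(mulmx0, mul0mx, addr0, add0r, row_mx0, col_mx0, mul_row_col, mul_mx_row).
rewrite !(mulmx0, mul0mx, addr0, add0r, row_mx0, col_mx0, rmorph1, mul1mx, mulmx1).
rewrite !add_row_mx !mul_col_mx !mul_row_col /block_mx ?mul_row_col.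
rewrite !(mulmx0, mul0mx, addr0, add0r, row_mx0, col_mx0, mulmx1).
have colrow (x : 'M[K]_1) : row_mx (col_mx x 0) 0 = col_mx (row_mx x 0) 0
    :> 'M_(1 + n, 1 + n).
  by rewrite -[X in row_mx _ X]col_mx0 -block_mxEh block_mxEv row_mx0.
rewrite colrow !mul_mx_row !add_col_mx !add_row_mx -!scalar_mxM -!raddfD /=.
rewrite !(mulmx0, mulmx1, addr0, add0r).
(* The four entries of the new binary Gram matrix follow: value 1, two zeros by orthogonality, and
   [ab] times the left side of [e1]. *)
have -> : sigma z * a%:A * z + sigma w * b%:A * w = 1.
  by rewrite -[RHS]e1 /norm; ring.
have sy : sigma y = - b%:A * w by rewrite rmorphM rmorphN /= gal_scalar ww.
have st : sigma t = a%:A * z by rewrite rmorphM /= gal_scalar zz.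
have -> : sigma z * a%:A * y + sigma w * b%:A * t = 0 by rewrite /y /t; ring.
have -> : sigma y * a%:A * z + sigma t * b%:A * w = 0 by rewrite sy st; ring.
have -> : sigma y * a%:A * y + sigma t * b%:A * t = (a * b)%:A.
  have abE : (a * b)%:A = a%:A * b%:A :> K by rewrite -!in_algE rmorphM.
  rewrite sy st abE -[RHS]mulr1 -[X in _ = _ * X]e1 /y /t /norm.
  by ring.
by rewrite raddf0 !col_mx0 !row_mx0.
Qed.

Lemma is_diag_mx_split n (D : 'M[F]_(1 + n)) :
  is_diag_mx D ->
  exists a E, is_diag_mx E /\ D = block_mx (a%:M : 'M_1) 0 0 E.
Proof.
rewrite -[D]submxK is_diag_block_mx // => /and4P[/eqP -> /eqP -> _ dE].
by exists (ulsubmx D 0 0), (drsubmx D); rewrite -mx11_scalar.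
Qed.

(** Induction on the size: merging the first two entries [a], [b] into [ab] keeps the determinant
    and lowers the rank by one. In rank one, the determinant being a norm is exactly what is
    wanted. *)
Lemma is_gram_det :
  (forall z, sigma (sigma z) = z) ->
  (forall a b : F, a != 0 -> b != 0 ->
     exists z w, a%:A * norm sigma z + b%:A * norm sigma w = 1) ->
  forall n (D : 'M[F]_n.+1),
    is_diag_mx D -> is_norm sigma (\det D) -> is_gram (map_mx (in_alg K) D).
Proof.
move=> sigmaK rep1; elim=> [|n IH] D dD.
  rewrite [D]mx11_scalar det_scalar1 => -[z z0 ez].
  exists z%:M; first by rewrite unitmxE det_scalar1 unitfE.
  by rewrite adjoint_scalar map_scalar_mx /= ez -scalar_mxM.
have [a [E [dE ->]]] := is_diag_mx_split (n := 1 + n) dD.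
have [b [{}D [{}dD ->]]] := is_diag_mx_split dE.
rewrite -[n.+2]/(1 + (1 + n))%N.
rewrite !det_ublock !det_scalar1 => nD.
have := is_norm_neq0 nD; rewrite !mulf_eq0 !negb_or => /and3P[a0 b0 _].
have [z [w zw]] := rep1 a b a0 b0.
rewrite !map_block_mx !map_scalar_mx !map_mx0.
apply: (is_gram_merge _ _ zw) => //.
have := IH (block_mx ((a * b)%:M : 'M_1) 0 0 D); rewrite -[n.+1]/(1 + n)%N.
rewrite map_block_mx map_scalar_mx !map_mx0; apply.
  by rewrite is_diag_block_mx // !eqxx scalar_mx_is_diag.
by rewrite det_ublock det_scalar1 -mulrA.
Qed.

End Gram.

(** * Conjugation on the quadratic extension, and binary forms representing 1 *)

Section QuadraticExtension.

Variables (F : fieldType) (K : splittingFieldType F) (sigma : gal_of {:K}).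

(** Every element of [K] is a polynomial in [s] over [F], and [tau] fixes its coefficients. *)
Lemma gal_fix_generator (s : K) (tau : gal_of {:K}) :
  <<1%VS; s>>%VS = {:K}%VS -> tau s = s -> tau = 1%g.
Proof.
move=> Ks ts; apply/eqP/gal_eqP => z _.
have : z \in <<1%AS; s>>%VS by rewrite Ks memvf.
rewrite gal_id; case/Fadjoin_polyP=> p p1 ->.
rewrite -horner_map /= ts; congr horner; apply/polyP => i.
by rewrite coef_map /=; have /vlineP[c ->] := polyOverP p1 i; rewrite gal_scalar.
Qed.

Lemma quadratic_rep1 (s : K) (d : F) :
  (forall a b : F, a != 0 -> b != 0 ->
     forall c : F, exists q : quaternion a b, quat_norm q = c) ->
  d != 0 -> s ^+ 2 = d%:A -> sigma s = - s ->
  forall a b : F, a != 0 -> b != 0 ->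
     exists z w, a%:A * norm sigma z + b%:A * norm sigma w = 1.
Proof.
move=> surj d0 s2 sN a b a0 b0.
have nE x y : norm sigma (x%:A + y%:A * s) = (x ^+ 2 - d * y ^+ 2)%:A.
  rewrite /norm rmorphD rmorphM /= !gal_scalar sN mulrN.
  by rewrite -subr_sqr exprMn s2 -!in_algE -!rmorphXn -rmorphM -rmorphB [d * _]mulrC.
(* By [nE], [a] times this quaternion norm is the value of [<a, b>] at [(x + ys, z + ws)]; the
   target [a^-1] makes it 1. *)
have [|[x y z w] /= e] := surj d (- b / a) d0 _ a^-1.
  by rewrite mulf_neq0 ?oppr_eq0 ?invr_eq0.
exists (x%:A + y%:A * s), (z%:A + w%:A * s); rewrite !nE.
rewrite -!in_algE -!rmorphM -rmorphD -(rmorph1 (in_alg K)); congr (in_alg K _).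
by rewrite -[RHS](divff a0) -[X in _ = _ * X]e /quat_norm /=; field.
Qed.

End QuadraticExtension.

(** * Cohomology classes and diagonal entries modulo norms *)

Section Classification.
Local Open Scope quotient_scope.

Variables (F : fieldType) (K : splittingFieldType F) (sigma : gal_of {:K}).

Lemma gram_diag_exists n (X : cocycle_type sigma n) :
  exists D : 'M[F]_n,
    [/\ D \in unitmx, is_diag_mx D &
      adjoint sigma (val X) *m val X = map_mx (in_alg K) D].
Proof. by case: X => X /= /asboolP[]. Qed.

(** The choice is harmless: [in_alg K] is injective, so the matrix is unique. *)
Definition gram_diag n (X : cocycle_type sigma n) : 'M[F]_n :=
  projT1 (cid (gram_diag_exists X)).

Lemma gram_diagP n (X : cocycle_type sigma n) :
  [/\ gram_diag X \in unitmx, is_diag_mx (gram_diag X) &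
    adjoint sigma (val X) *m val X = map_mx (in_alg K) (gram_diag X)].
Proof. exact: projT2 (cid (gram_diag_exists X)). Qed.

Lemma diag_mxE n (R : pzRingType) (D : 'M[R]_n) :
  is_diag_mx D -> D = diag_mx (\row_i D i i).
Proof.
move=> /is_diag_mxP dD; apply/matrixP => i j; rewrite !mxE.
by have [->|/dD ->] := eqVneq i j; rewrite ?mulr1n ?mulr0n.
Qed.

Lemma det_is_diag n (R : comPzRingType) (D : 'M[R]_n) :
  is_diag_mx D -> \det D = \prod_i D i i.
Proof.
by move=> /diag_mxE {1}->; rewrite det_diag; apply: eq_bigr => i _; rewrite mxE.
Qed.

Lemma gram_diag_prod n (X : cocycle_type sigma n) :
  is_norm sigma (\prod_i gram_diag X i i).
Proof.
have [uD dD eD] := gram_diagP X; rewrite -det_is_diag //.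
exists (\det (val X)); last by rewrite -det_gram eD det_map_mx.
by case: X {uD dD eD} => X /= /asboolP[]; rewrite unitmxE unitfE.
Qed.

Lemma gram_diag_neq0 n (X : cocycle_type sigma n) i : gram_diag X i i != 0.
Proof.
have := is_norm_neq0 (gram_diag_prod X).
by rewrite (bigD1 i) //= mulf_eq0 negb_or => /andP[].
Qed.

(** If [Y = Q X D], then [Y^* Y = D^* (X^* X) D], so the entries change by the norms of the [D i i].
    Conversely, pick [D] with these norms; [Y] and [X D] then have equal Gram matrices and differ by
    a unitary factor. *)
Lemma cohomologous_gram n (X Y : cocycle_type sigma n) :
  cohomologous sigma (val X) (val Y) <->
  forall i, is_norm sigma (gram_diag Y i i / gram_diag X i i).
Proof.
have [uX dX eX] := gram_diagP X; have [uY dY eY] := gram_diagP Y.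
have X0 := gram_diag_neq0 X.
have uvX : val X \in unitmx by case: {+}X => Z /= /asboolP[].
have uvY : val Y \in unitmx by case: {+}Y => Z /= /asboolP[].
split=> [[Q [D [[uQ QQ] uD dD e]]] i|h].
  have : adjoint sigma (val Y) *m val Y =
      adjoint sigma D *m map_mx (in_alg K) (gram_diag X) *m D.
    rewrite -eX e !adjointM !mulmxA; congr (_ *m _ *m _).
    by rewrite -mulmxA QQ mulmx1.
  rewrite eY (diag_mxE dD) (diag_mxE dX) /adjoint !map_diag_mx !tr_diag_mx.
  rewrite !mulmx_diag => /matrixP/(_ i i); rewrite !mxE eqxx !mulr1n /= => ei.
  exists (D i i).
    have := uD; rewrite unitmxE (det_is_diag dD) unitfE (bigD1 i) //=.
    by rewrite mulf_eq0 negb_or => /andP[].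
  rewrite -in_algE rmorphM fmorphV /= ei /norm mulrAC mulfK //.
  by rewrite -in_algE fmorph_eq0.
pose t i := s2val (cid2 (h i)).
have t0 i : t i != 0 := s2valP (cid2 (h i)).
have tE i : (gram_diag Y i i / gram_diag X i i)%:A = norm sigma (t i) :=
  s2valP' (cid2 (h i)).
pose D := diag_mx (\row_i t i).
have uD : D \in unitmx.
  by rewrite unitmxE det_diag unitfE; apply/prodf_neq0 => i _; rewrite mxE.
have eD : adjoint sigma (val Y) *m val Y =
    adjoint sigma D *m (adjoint sigma (val X) *m val X) *m D.
  rewrite eX eY (diag_mxE dX) (diag_mxE dY) /adjoint !map_diag_mx !tr_diag_mx.
  rewrite !mulmx_diag; congr diag_mx; apply/rowP => i; rewrite !mxE.
  by rewrite mulrAC -/(norm sigma (t i)) -tE -in_algE -rmorphM divfK.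
(* The equation [Y = Q X D] forces this [Q]; unitarity follows from [eD]. *)
exists (val Y *m invmx D *m invmx (val X)), D; split=> //.
- split; first by rewrite !unitmx_mul uvY !unitmx_inv uD uvX.
  rewrite !adjointM !mulmxA -(mulmxA _ (adjoint sigma (val Y))) eD.
  have uu M : M \in unitmx -> adjoint sigma (invmx M) *m adjoint sigma M = 1%:M.
    by move=> uM; rewrite -adjointM mulmxV // adjoint1.
  rewrite !mulmxA -(mulmxA _ (adjoint sigma (invmx D))) uu // mulmx1.
  by rewrite uu // mul1mx mulmxK // mulmxV.
- exact: diag_mx_is_diag.
- by rewrite mulmxKV // mulmxKV.
Qed.

(** Entry [ord0] is dropped, being determined modulo norms by the others. By [cohomologous_gram],
    any representative of [q] would give the same classes. *)
Definition gram_class m (q : H1_d sigma m.+1) : {ffun 'I_m -> norm_classes sigma} :=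
  [ffun i : 'I_m =>
     \pi_(norm_classes sigma)
       (Sub (gram_diag (repr q) (lift ord0 i) (lift ord0 i))
            (gram_diag_neq0 _ _) : nonzero F)].

Lemma gram_class_inj m : injective (@gram_class m).
Proof.
move=> q r eqr; rewrite -[q]reprK -[r]reprK; apply/eqmodP => /=.
apply/asboolP/cohomologous_gram.
set X := repr q; set Y := repr r.
have hl i : is_norm sigma (gram_diag Y (lift ord0 i) (lift ord0 i)
                           / gram_diag X (lift ord0 i) (lift ord0 i)).
  by have /ffunP/(_ i) := esym eqr; rewrite !ffunE => /eqmodP/asboolP.
move=> i; case: (unliftP ord0 i) => [j ->|->]; first exact: hl.
(* The product of all the ratios is a norm; dividing by the ratios away from [ord0] leaves the one
   at [ord0]. *)
have := is_normM (gram_diag_prod Y) (is_normV (gram_diag_prod X)).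
rewrite -prodf_div big_ord_recl => h.
have hp := is_norm_prod hl.
have := is_normM h (is_normV hp); rewrite mulfK //; exact: is_norm_neq0 hp.
Qed.

Lemma gram_class_surj m :
  (forall D : 'M[F]_m.+1,
    is_diag_mx D -> is_norm sigma (\det D) -> is_gram sigma (map_mx (in_alg K) D)) ->
  forall y, exists q, @gram_class m q = y.
Proof.
move=> gr y; pose x i : F := val (repr (y i)).
have x0 i : x i != 0 := valP (repr (y i)).
(* The default value of [oapp] is the entry at [ord0], chosen to give determinant 1, which is a
   norm. *)
pose e (i : 'I_m.+1) := oapp x (\prod_j x j)^-1 (unlift ord0 i).
pose D := diag_mx (\row_i e i).
have det1 : \det D = 1.
  rewrite det_diag big_ord_recl !mxE /e unlift_none /=.
  rewrite [X in _ * X](eq_bigr x) => [|i _]; last by rewrite mxE liftK.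
  by rewrite mulVf //; apply/prodf_neq0 => i _.
have [|X uX eX] := gr D (diag_mx_is_diag _); first by rewrite det1; exact: is_norm1.
have cX : `[< cocycle sigma X >].
  apply/asboolP; split=> //; exists D; split=> //; last exact: diag_mx_is_diag.
  by rewrite unitmxE det1 unitr1.
pose Xc : cocycle_type sigma m.+1 := exist _ X cX.
exists (\pi Xc); apply/ffunP => i; rewrite ffunE -[y i]reprK.
apply/eqmodP/asboolP => /=.
(* [repr] may return a cocycle other than [Xc], but a cohomologous one, so its entries agree with
   those of [Xc] modulo norms. *)
have : cohomologous sigma (val Xc) (val (repr (\pi_(H1_d sigma m.+1) Xc))).
  by apply/asboolP; have /eqmodP := esym (reprK (\pi_(H1_d sigma m.+1) Xc)).
move=> /cohomologous_gram/(_ (lift ord0 i)).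
suff -> : gram_diag Xc (lift ord0 i) (lift ord0 i) = x i by [].
have [_ _] := gram_diagP Xc; rewrite eX => /matrixP/(_ (lift ord0 i) (lift ord0 i)).
rewrite !mxE eqxx mulr1n /e liftK /= => /(fmorph_inj (in_alg K)) //.
Qed.

End Classification.

Theorem proposition5p1 (F : fieldType)
    (charF : [pchar F] =i pred0)
    (quat_norm_surj : forall a b : F, a != 0 -> b != 0 ->
       forall c : F, exists q : quaternion a b, quat_norm q = c)
    (d : F) (d_neq0 : d != 0) (d_nonsquare : ~ exists x : F, x ^+ 2 = d)
    (K : splittingFieldType F) (sqrtd : K) (sqrtdE : sqrtd ^+ 2 = d%:A)
    (K_gen : <<1%VS; sqrtd>>%VS = {:K}%VS)
    (sigma : gal_of {:K}) (sigma_gal : sigma \in 'Gal({:K} / 1)%g)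
    (sigma_neq1 : sigma != 1%g)
    (n : nat) (n_gt0 : (0 < n)%N) :
  exists f : H1_d sigma n -> {ffun 'I_n.-1 -> norm_classes sigma}, bijective f.
Proof.
(* The image of [sqrtd] is again a square root of [d]; if it were [sqrtd] itself, [sigma] would be
   trivial. *)
have sN : sigma sqrtd = - sqrtd.
  have /eqP : sigma sqrtd ^+ 2 = sqrtd ^+ 2 by rewrite -rmorphXn sqrtdE /= gal_scalar.
  rewrite eqf_sqr => /orP[/eqP ss|/eqP //].
  by rewrite (gal_fix_generator K_gen ss) eqxx in sigma_neq1.
have sigmaK z : sigma (sigma z) = z.
  have ss1 : (sigma * sigma = 1)%g.
    by apply: (gal_fix_generator K_gen); rewrite galM ?memvf // sN rmorphN /= sN opprK.
  by rewrite -galM ?memvf // ss1 gal_id.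
have rep1 := quadratic_rep1 quat_norm_surj d_neq0 sqrtdE sN.
case: n n_gt0 => // m _; exists (@gram_class _ _ sigma m).
have surj := gram_class_surj (is_gram_det sigmaK rep1 (n := m)).
(* A right inverse chosen by surjectivity; injectivity makes it two-sided. *)
pose g y := projT1 (cid (surj y)).
have gK : cancel g (@gram_class _ _ sigma m) by move=> y; exact: projT2 (cid (surj y)).
by exists g => // q; apply: gram_class_inj; rewrite gK.
Qed.
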